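(* Let $(X,\nu)$ be a standard Borel space with a non-atomic finite non-negative measure $\nu$, and let $\tilde P_\Gamma$ be the quasi-Lebesgue measure on $D^+$. For each $a\in\mathcal{M}$, the measure $\tilde P_\Gamma$ is quasi-invariant under $M_a$ with a constant density $$\frac{dM_a(\tilde P_\Gamma)}{d\tilde P_\Gamma}=\exp\left(-\int_X\log a(x)\,d\nu(x)\right).$$
   Context: $D^+$ is the cone of finite positive discrete measures $\sum z_i\delta_{x_i}$ ($x_i\in X$, $z_i>0$, $\sum z_i<\infty$) on $X$, with the $\sigma$-algebra generated by $\eta\mapsto\eta(A)$, $A\subset X$ Borel. The gamma measure $P_\Gamma=P_\Gamma(\nu)$ is the probability law on $D^+$ determined by $\mathbb{E}_\Gamma\left[\exp\left(-\int_X a\,d\eta\right)\right]=\exp\left(-\int_X\log(1+a)\,d\nu\right)$ for every non-negative bounded Borel function $a$ on $X$. The quasi-Lebesgue measure $\tilde P_\Gamma$ is the $\sigma$-finite measure on $D^+$ defined by $\frac{d\tilde P_\Gamma}{dP_\Gamma}(\eta)=\exp(\eta(X))$. $\mathcal{M}=\{a:X\to\mathbb{R}_+ : \int_X|\log a(x)|\,d\nu(x)<\infty\}$ is the set of (classes mod $0$ of) non-negative measurable functions with $\nu$-summable logarithm. For $a\in\mathcal{M}$, $M_a\eta=\sum a(x_i)z_i\delta_{x_i}$ for $\eta=\sum z_i\delta_{x_i}$ (defined almost everywhere), and $M_a(\tilde P_\Gamma)$ is the image measure. *)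

(* Defs.v *)
From HB Require Import structures.
From mathcomp Require Import all_boot all_order all_algebra.
From mathcomp Require Import all_classical all_reals all_analysis.
From mathcomp Require Import measurable_realfun.

Set Implicit Arguments.
Unset Strict Implicit.
Unset Printing Implicit Defensive.

Import Order.TTheory GRing.Theory Num.Theory.
Import numFieldNormedType.Exports.

Local Open Scope classical_set_scope.
Local Open Scope ring_scope.

(* A complete pseudometric structure that is Hausdorff and second countable
   makes [T] a Polish space; [X] has to be Borel isomorphic to some such [T]. *)
Definition standard_borel (R : realType) d (X : measurableType d) : Prop :=
  exists (T : completePseudoMetricType R) (f : X -> T),
    [/\ hausdorff_space T, @second_countable T, bijective f &
        forall A : set X, measurable A <-> <<s [set U : set T | open U] >> (f @` A)].

Definition non_atomic (R : realType) d (X : measurableType d)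
    (nu : set X -> \bar R) : Prop :=
  forall A, measurable A -> (0 < nu A)%E ->
    exists B, [/\ measurable B, B `<=` A & (0 < nu B < nu A)%E].

Section atomic_measure.
Context d (X : measurableType d) (R : realType).
Implicit Types (x : nat -> X) (z : nat -> {nonneg R}).

(* [A |-> \sum_i z_i \d_(x_i) A]. Null weights only pad the sequence, so that
   one encoding covers both the finite and the countably infinite families of
   positive weights. The value is meaningful on every subset [A] of [X]. *)
Definition atomic_measure x z : set X -> \bar R :=
  mseries (fun i => mscale (z i) \d_(x i)) 0.

HB.instance Definition _ x z := Measure.on (atomic_measure x z).

Lemma atomic_measureE x z A :
  atomic_measure x z A = (\sum_(i <oo) (z i)%:num%:E * \d_(x i) A)%E.
Proof. by []. Qed.

Lemma atomic_measureT x z :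
  atomic_measure x z setT = (\sum_(i <oo) (z i)%:num%:E)%E.
Proof.
by rewrite atomic_measureE; apply: eq_eseriesr => i _; rewrite diracT mule1.
Qed.

Lemma ge0_integral_atomic_measure x z (D : set X) (f : X -> \bar R) :
  measurable D -> measurable_fun D f -> (forall t, D t -> 0 <= f t)%E ->
  (\int[atomic_measure x z]_(t in D) f t =
   \sum_(i <oo) (z i)%:num%:E * (\d_(x i) D * f (x i)))%E.
Proof.
move=> mD mf f0; rewrite /atomic_measure ge0_integral_measure_series//.
apply: eq_eseriesr => i _.
by rewrite ge0_integral_mscale// integral_dirac.
Qed.

End atomic_measure.

(* The extra argument carries finiteness of the total mass. *)
Definition fin_atomic_measure d (X : measurableType d) (R : realType)
    (x : nat -> X) (z : nat -> {nonneg R})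
    (_ : (atomic_measure x z setT < +oo)%E) : set X -> \bar R :=
  atomic_measure x z.

Section fin_atomic_measure.
Context d (X : measurableType d) (R : realType).
Variables (x : nat -> X) (z : nat -> {nonneg R}).
Hypothesis zoo : (atomic_measure x z setT < +oo)%E.

HB.instance Definition _ := Measure.on (fin_atomic_measure zoo).

Let fin_atomic_measure_fin : fin_num_fun (fin_atomic_measure zoo).
Proof.
move=> A mA; rewrite ge0_fin_numE// (le_lt_trans _ zoo)//.
by apply: (@le_measure _ _ _ (atomic_measure x z)); rewrite ?inE.
Qed.

HB.instance Definition _ :=
  Measure_isFinite.Build _ _ _ (fin_atomic_measure zoo) fin_atomic_measure_fin.

End fin_atomic_measure.

(* The cone D^+. The representation as an atomic measure is an equality of
   functions on all subsets of [X]: it fixes the otherwise irrelevant values on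
   non-measurable sets. *)
Record Dplus d (X : measurableType d) (R : realType) := MkDplus {
  dplus_measure :> {finite_measure set X -> \bar R} ;
  dplus_atomic : exists xz : (nat -> X) * (nat -> {nonneg R}),
    dplus_measure = atomic_measure xz.1 xz.2 :> (set X -> \bar R)
}.
Arguments Dplus {d} X R.


Section atomic_scale.
Context d (X : measurableType d) (R : realType).
Implicit Types (a : X -> {nonneg R}) (x : nat -> X) (z : nat -> {nonneg R}).

(* The weights a(x_i) z_i. *)
Definition scale_weights a x z : nat -> {nonneg R} :=
  fun i => ((a (x i))%:num * (z i)%:num)%:nng.

Lemma integral_scale_weights a x z (D : set X) :
  measurable D -> measurable_fun D (fun t => (a t)%:num) ->
  (\int[atomic_measure x z]_(t in D) (a t)%:num%:E =
   atomic_measure x (scale_weights a x z) D)%E.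
Proof.
move=> mD ma; have mf : measurable_fun D (fun t => (a t)%:num%:E) by exact/measurable_EFinP.
rewrite ge0_integral_atomic_measure//.
rewrite atomic_measureE; apply: eq_eseriesr => i _ /=.
by rewrite EFinM muleC -muleA muleC.
Qed.

End atomic_scale.

(* All subsets are made measurable to get the result for an arbitrary [A]. *)
Lemma atomic_scale_indep d (X : measurableType d) (R : realType)
    (a : X -> {nonneg R}) (x y : nat -> X) (z w : nat -> {nonneg R}) :
  atomic_measure x z = atomic_measure y w ->
  atomic_measure x (scale_weights a x z) = atomic_measure y (scale_weights a y w).
Proof.
move=> xzyw; apply/funext => A.
pose Y := g_sigma_algebraType [set: set X].
have mY (B : set Y) : measurable B by exact: sub_gen_smallest.
have maY : measurable_fun (A : set Y) (fun t : Y => (a t)%:num) by [].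
have := @integral_scale_weights _ Y R a x z A (mY A) maY.
have := @integral_scale_weights _ Y R a y w A (mY A) maY.
have -> : @atomic_measure _ Y R x z = @atomic_measure _ Y R y w by exact: xzyw.
by move=> -> /esym.
Qed.

Section Dplus_measurable.
Context d (X : measurableType d) (R : realType).

Lemma Dplus_eq (eta zeta : Dplus X R) :
  eta = zeta :> (set X -> \bar R) -> eta = zeta.
Proof.
case: eta zeta => [e pe] [f pf] /= ef.
have cef : e = f.
  case: e f {pe pf} ef => [e ce] [f cf] /= ef.
  subst f; congr FiniteMeasure.Pack.
  case: ce cf => [[a1 b1] [c1] [d1] [e1] [f1]] [[a2 b2] [c2] [d2] [e2] [f2]].
  rewrite (Prop_irrelevance a1 a2) (Prop_irrelevance b1 b2).
  rewrite (Prop_irrelevance d1 d2) (Prop_irrelevance e1 e2).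
  by rewrite (Prop_irrelevance f1 f2) (Prop_irrelevance c1 c2).
subst f.
by rewrite (Prop_irrelevance pe pf).
Qed.

Lemma atomic_null_lty :
  (atomic_measure (R := R) (fun=> @point X) (fun=> (0%:nng)%R) setT < +oo)%E.
Proof. by rewrite atomic_measureT eseries0// => i _. Qed.

Definition Dplus0 : Dplus X R :=
  @MkDplus _ _ _ (fin_atomic_measure atomic_null_lty)
    (ex_intro _ (fun=> @point X, fun=> (0%:nng)%R) erefl).

HB.instance Definition _ := gen_eqMixin (Dplus X R).
HB.instance Definition _ := gen_choiceMixin (Dplus X R).
HB.instance Definition _ := isPointed.Build (Dplus X R) Dplus0.

Definition Dplus_measurable : set (set (Dplus X R)) :=
  <<s \bigcup_(A in @measurable _ X) preimage_set_system [set: Dplus X R]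
        (fun eta : Dplus X R => eta A) measurable >>.

Let Dplus_measurable0 : Dplus_measurable set0.
Proof. exact: sigma_algebra0. Qed.

Let Dplus_measurableC U : Dplus_measurable U -> Dplus_measurable (~` U).
Proof. exact: sigma_algebraC. Qed.

Let Dplus_measurableU (F : (set (Dplus X R))^nat) :
  (forall i, Dplus_measurable (F i)) -> Dplus_measurable (\bigcup_i F i).
Proof. exact: sigma_algebra_bigcup. Qed.

Definition Dplus_display : measure_display. Proof. by constructor. Qed.

HB.instance Definition _ := @isMeasurable.Build Dplus_display (Dplus X R)
  Dplus_measurable Dplus_measurable0 Dplus_measurableC Dplus_measurableU.

Lemma measurable_Dplus_ev (A : set X) : measurable A ->
  measurable_fun [set: Dplus X R] (fun eta : Dplus X R => eta A).
Proof.
move=> mA; apply: (@measurability Dplus_display _ (Dplus X R) _ setT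
    (fun eta : Dplus X R => eta A) measurable).
  by rewrite smallest_id//; exact: sigma_algebra_measurable.
apply: subset_trans; last exact: sub_gen_smallest.
exact: (bigcup_sup mA).
Qed.

Import HBNNSimple.

Lemma measurable_Dplus_integral (f : X -> \bar R) :
  measurable_fun [set: X] f -> (forall x, 0 <= f x)%E ->
  measurable_fun [set: Dplus X R] (fun eta : Dplus X R => \int[eta]_x f x)%E.
Proof.
move=> mf h0.
pose g := nnsfun_approx measurableT mf.
pose intEg := fun n (eta : Dplus X R) => (\int[eta]_x (EFin \o g n) x)%E.
have mintgE n : measurable_fun [set: Dplus X R] (intEg n).
  rewrite /intEg /=.
  under eq_fun do rewrite integralT_nnsfun sintegralE.
  apply: emeasurable_fsum => //= r.
  by apply: measurable_funeM => //=; exact: measurable_Dplus_ev.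
apply: (emeasurable_fun_cvg _ _ mintgE) => eta _.
rewrite (_ : (\int[eta]_x f x = \int[eta]_x limn (fun n => (EFin \o g n) x))%E).
  apply: cvg_monotone_convergence => //.
  - by move=> n; exact/measurable_EFinP.
  - by move=> n x _; rewrite lee_fin.
  - by move=> t _ n m nm; apply/lefP/nd_nnsfun_approx.
apply: eq_integral => t _.
by apply/esym/cvg_lim  => //; exact/cvg_nnsfun_approx.
Qed.

Lemma Dplus_lty (eta : Dplus X R) : (eta setT < +oo)%E.
Proof. by rewrite -ge0_fin_numE// fin_num_measure. Qed.

End Dplus_measurable.

Section multiplicator.
Context d (X : measurableType d) (R : realType).
Implicit Types (a : X -> {nonneg R}) (eta : Dplus X R).

Definition atoms eta : nat -> X := (projT1 (cid (dplus_atomic eta))).1.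

Definition weights eta : nat -> {nonneg R} := (projT1 (cid (dplus_atomic eta))).2.

Lemma atomsE eta : eta = atomic_measure (atoms eta) (weights eta) :> (set X -> \bar R).
Proof. by rewrite /atoms /weights; case: cid. Qed.

(* \sum_i a(x_i) z_i \d_(x_i), possibly of infinite total mass; it does not
   depend on the chosen representation of [eta], see [mul_atomicE]. *)
Definition mul_atomic a eta : set X -> \bar R :=
  atomic_measure (atoms eta) (scale_weights a (atoms eta) (weights eta)).

Lemma mul_atomicE a eta (x : nat -> X) (z : nat -> {nonneg R}) :
  eta = atomic_measure x z :> (set X -> \bar R) ->
  mul_atomic a eta = atomic_measure x (scale_weights a x z).
Proof. by move=> etaE; apply: atomic_scale_indep; rewrite -atomsE. Qed.

Lemma mul_atomic_integral a eta (D : set X) :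
  measurable D -> measurable_fun D (fun t => (a t)%:num) ->
  mul_atomic a eta D = (\int[eta]_(t in D) (a t)%:num%:E)%E.
Proof. by move=> mD ma; rewrite atomsE integral_scale_weights. Qed.

Definition mul_defined a : set (Dplus X R) :=
  [set eta | mul_atomic a eta setT < +oo]%E.

(* The partial map M_a, extended by the zero measure outside of its domain. *)
Definition mul_map a eta : Dplus X R :=
  match pselect (mul_defined a eta) with
  | left h => @MkDplus _ _ _ (fin_atomic_measure h)
      (ex_intro _ (atoms eta, scale_weights a (atoms eta) (weights eta)) erefl)
  | right _ => Dplus0 X R
  end.

Lemma mul_mapE a eta : mul_defined a eta ->
  mul_map a eta = mul_atomic a eta :> (set X -> \bar R).
Proof. by rewrite /mul_map; case: pselect. Qed.

Lemma mul_mapN a eta : ~ mul_defined a eta -> mul_map a eta = Dplus0 X R.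
Proof. by rewrite /mul_map; case: pselect. Qed.

Lemma measurable_mul_atomic a (D : set X) : measurable D ->
  measurable_fun setT (fun t => (a t)%:num) ->
  measurable_fun setT (fun eta : Dplus X R => mul_atomic a eta D).
Proof.
move=> mD ma.
have maD : measurable_fun D (fun t => (a t)%:num) by exact: measurable_funTS.
rewrite (_ : (fun _ => _) = (fun eta : Dplus X R =>
    \int[eta]_t ((fun t => (a t)%:num%:E) \_ D) t)%E); last first.
  by apply/funext => eta; rewrite mul_atomic_integral// integral_mkcond.
apply: measurable_Dplus_integral.
  by apply/(measurable_restrictT _ mD)/measurable_funTS/measurable_EFinP.
by move=> x; rewrite patchE; case: ifPn => // _; rewrite lee_fin.
Qed.

Lemma measurable_mul_defined a : measurable_fun setT (fun t => (a t)%:num) ->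
  measurable (mul_defined a).
Proof.
move=> ma; rewrite /mul_defined -[X in measurable X]setTI.
by apply: emeasurable_fun_infty_o => //; exact: measurable_mul_atomic.
Qed.

Lemma measurable_mul_map a : measurable_fun setT (fun t => (a t)%:num) ->
  measurable_fun setT (mul_map a).
Proof.
move=> ma; apply: (@measurability _ _ _ (Dplus X R) setT (mul_map a)
  (\bigcup_(A in @measurable _ X) preimage_set_system [set: Dplus X R]
        (fun eta : Dplus X R => eta A) measurable)) => //.
move=> _ [_ [A mA [B mB <-]] <-]; rewrite !setTI -comp_preimage.
rewrite -[X in measurable X]setTI.
suff : measurable_fun setT (fun eta : Dplus X R => mul_map a eta A) by exact.
rewrite (_ : (fun _ => _) = (fun eta => if eta \in mul_defined a
  then mul_atomic a eta A else Dplus0 X R A)); last first.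
  apply/funext => eta; case: ifPn => [/set_mem/mul_mapE ->//|/negP h].
  by rewrite mul_mapN// => h'; apply: h; rewrite inE.
apply: measurable_fun_ifT => //.
- apply: (measurable_fun_bool true); rewrite setTI (_ : _ @^-1` _ = mul_defined a).
    exact: measurable_mul_defined.
  by apply/seteqP; split=> eta /=; [move/set_mem|move/mem_set].
- exact: measurable_mul_atomic.
Qed.

End multiplicator.

(* [P] is the gamma measure with parameter [nu]: its Laplace functional
   determines it. *)
Definition is_gamma_measure d (X : measurableType d) (R : realType)
    (nu : {finite_measure set X -> \bar R}) (P : probability (Dplus X R) R) : Prop :=
  forall a : X -> R, measurable_fun setT a -> (forall x, 0 <= a x) ->
    (exists C, forall x, a x <= C) ->
    ('E_P[fun eta => expR (- \int[eta]_x a x)%R] =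
      (expR (- \int[nu]_x ln (1 + a x))%R)%:E)%E.

Section quasi_lebesgue.
Local Open Scope ereal_scope.
Context d (X : measurableType d) (R : realType) (P : probability (Dplus X R) R).

(* The measure of density [exp (eta X)] with respect to [P]. *)
Definition quasi_lebesgue (B : set (Dplus X R)) : \bar R :=
  \int[P]_(eta in B) expeR (eta setT).

Lemma measurable_expeR_mass :
  measurable_fun [set: Dplus X R] (fun eta : Dplus X R => expeR (eta setT)).
Proof.
rewrite (_ : (fun _ => _) = (fun eta : Dplus X R => (expR (fine (eta setT)))%:E)).
  apply/measurable_EFinP; apply: measurableT_comp => //.
  by apply: measurableT_comp => //; exact: measurable_Dplus_ev.
by apply/funext => eta; rewrite -[in LHS](fineK (fin_num_measure eta _ measurableT)).
Qed.

Let quasi_lebesgue0 : quasi_lebesgue set0 = 0.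
Proof. exact: integral_set0. Qed.

Let quasi_lebesgue_ge0 B : 0 <= quasi_lebesgue B.
Proof. by apply: integral_ge0 => eta _; exact: expeR_ge0. Qed.

Let quasi_lebesgue_sigma_additive : semi_sigma_additive quasi_lebesgue.
Proof.
move=> F mF tF mUF; rewrite [X in _ --> X](_ : _ =
    \sum_(0 <= i <oo) quasi_lebesgue (F i)).
  by apply: is_cvg_ereal_nneg_natsum => n _; exact: quasi_lebesgue_ge0.
apply: ge0_integral_bigcup => //.
- by apply: measurable_funTS; exact: measurable_expeR_mass.
- by move=> eta _; exact: expeR_ge0.
Qed.

HB.instance Definition _ := isMeasure.Build _ _ _ quasi_lebesgue
  quasi_lebesgue0 quasi_lebesgue_ge0 quasi_lebesgue_sigma_additive.

Let quasi_lebesgue_sigma_finite : sigma_finite setT quasi_lebesgue.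
Proof.
exists (fun n => [set eta : Dplus X R | eta setT <= n%:R%:E]).
  apply/seteqP; split => // eta _.
  exists (Num.bound (fine (eta setT))) => //=.
  rewrite -(fineK (fin_num_measure eta _ measurableT)) lee_fin ltW//.
  by apply: archi_boundP; exact: fine_ge0.
move=> n; have mn : measurable [set eta : Dplus X R | eta setT <= n%:R%:E].
  rewrite -[X in measurable X]setTI.
  by apply: emeasurable_fun_infty_c => //; exact: measurable_Dplus_ev.
split=> //; apply: (@le_lt_trans _ _
    (\int[P]_(eta in [set eta : Dplus X R | eta setT <= n%:R%:E]) (expR n%:R)%:E)).
  apply: ge0_le_integral => //.
  - by move=> eta _; exact: expeR_ge0.
  - by apply: measurable_funTS; exact: measurable_expeR_mass.
  - by move=> eta /= h; rewrite -[leRHS]/(expeR n%:R%:E) lee_expeR.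
rewrite integral_cst// lte_mul_pinfty ?lee_fin ?expR_ge0//.
by rewrite (le_lt_trans (probability_le1 P mn))// ltry.
Qed.

HB.instance Definition _ := Measure_isSigmaFinite.Build _ _ _ quasi_lebesgue
  quasi_lebesgue_sigma_finite.

End quasi_lebesgue.

(* Membership in the class M. With [lne 0 = -oo], integrability forces [a > 0]
   almost everywhere; [ln] would not do, because [ln 0 = 0]. *)
Definition log_summable d (X : measurableType d) (R : realType)
    (nu : {measure set X -> \bar R}) (a : X -> {nonneg R}) : Prop :=
  measurable_fun setT (fun x => (a x)%:num) /\
  (\int[nu]_x `|lne (a x)%:num%:E| < +oo)%E.

(* [mu'] has density [f] with respect to [mu]. *)
Definition has_density d (T : measurableType d) (R : realType)
    (mu mu' : set T -> \bar R) (f : T -> \bar R) : Prop :=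
  forall B, measurable B -> (mu' B = \int[mu]_(t in B) f t)%E.

(* Main.v *)
Require Import Defs.
From HB Require Import structures.
From mathcomp Require Import all_boot all_order all_algebra.
From mathcomp Require Import all_classical all_reals all_analysis.
From mathcomp Require Import measurable_realfun.
From mathcomp Require Import lra ring.

(** The Laplace functional of the gamma measure turns the statement into the
    rule [log (a g) = log a + log g].

    Write [eta(f)] for the integral of [f] against [eta], and [P], [Q] for the
    gamma and the quasi-Lebesgue measure. Since [Q] has density [exp eta(1)]
    with respect to [P], the Laplace functional of [Q] at [g] is that of [P] at
    [g - 1], hence formally [exp (- \int log g)]. As [(M_a eta)(g) = eta(a g)],
    the image of [Q] has Laplace functional [exp (- \int log (a g))], that is
    [exp (- \int log a)] times the Laplace functional of [Q], so the two
    measures are proportional.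

    Two points need care. First, the Laplace functional of [P] is available for
    nonnegative functions only, so [g] and [a g] both have to be at least [1].
    Take [g = g0 + h] with [g0 = max (1, 1/a)] and [h] nonnegative and bounded;
    then [a g0 = max (a, 1)] wherever [a] is positive, that is almost everywhere.
    Let [excess r = max (r - 1, 0)]. Since [g0 - 1 = excess (1/a)] and
    [a g0 - 1 = excess a], weighting [Q] by
    [exp (- eta(g0))] gives the measure of density
    [exp (- eta(excess (1/a)))] with respect to [P], and weighting the image of
    [Q] in the same way gives the image under [M_a] of the measure of density
    [exp (- eta(excess a))]. Both weighted measures are finite, and the formal
    computation above becomes rigorous for them. The function [g0] is unbounded,
    whence the extension [gamma_laplace] of the Laplace formula to unbounded
    functions. The same formula at [f / n] shows that [eta(f)] is finite almost
    surely as soon as [log (1 + f)] is summable ([gamma_ae_finite]); so [M_a] is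
    defined almost everywhere, and the weights vanish almost nowhere and can be
    removed at the end.

    Second, a finite measure on the cone has to be determined by its Laplace
    functional ([eq_measure_Dplus]). The functions [exp (- eta(h))] take values
    in [[0, 1]] and are closed under products, and for [u] among them the
    polynomials [(1 - u^n)^(n 2^n)] in [u] converge pointwise to the indicator
    of [u < 1/2]. A monotone class argument, [multiplicative_uniqueness], gives
    the equality on the sigma-algebra generated by the sets [u < 1/2], which
    contains all the sets [t < eta(A)]. *)

Set Implicit Arguments.
Unset Strict Implicit.
Unset Printing Implicit Defensive.
Import Order.TTheory GRing.Theory Num.Theory.
Import numFieldNormedType.Exports.
Local Open Scope classical_set_scope.
Local Open Scope ring_scope.

(** * Measures with a density and image measures *)

Section density.
Local Open Scope ereal_scope.
Context d (T : measurableType d) (R : realType).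
Variables (mu : {measure set T -> \bar R}) (w : T -> \bar R).
Hypotheses (mw : measurable_fun setT w) (w0 : forall x, 0 <= w x).

(** The measure of density [w]. The two proofs are arguments so that the measure
    structure can be inferred from the term. *)
Definition with_density (_ : measurable_fun setT w) (_ : forall x, 0 <= w x)
  (B : set T) : \bar R := \int[mu]_(x in B) w x.

Let with_density0 : with_density mw w0 set0 = 0.
Proof. exact: integral_set0. Qed.

Let with_density_ge0 B : 0 <= with_density mw w0 B.
Proof. exact: integral_ge0. Qed.

Let with_density_sigma_additive : semi_sigma_additive (with_density mw w0).
Proof.
move=> F mF tF mUF; rewrite [X in _ --> X](_ : _ =
    \sum_(0 <= i <oo) with_density mw w0 (F i)).
  by apply: is_cvg_ereal_nneg_natsum => n _; exact: with_density_ge0.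
by apply: ge0_integral_bigcup => //; exact: measurable_funTS.
Qed.

HB.instance Definition _ := isMeasure.Build _ _ _ (with_density mw w0)
  with_density0 with_density_ge0 with_density_sigma_additive.

Import HBNNSimple.

Lemma ge0_integral_has_density (mu' : {measure set T -> \bar R}) (f : T -> \bar R) :
  (forall x, w x \is a fin_num) ->
  has_density mu mu' w -> measurable_fun setT f -> (forall x, 0 <= f x) ->
  \int[mu']_x f x = \int[mu]_x (f x * w x).
Proof.
move=> wfin mu'E mf f0.
pose f_ := nnsfun_approx measurableT mf.
have f_cvg x : (f_ n x)%:E @[n --> \oo] --> f x by exact: cvg_nnsfun_approx.
have f_nd x : {homo (fun n => (f_ n x)%:E) : m n / (m <= n)%N >-> m <= n}.
  by move=> m n mn; rewrite lee_fin; exact/lefP/nd_nnsfun_approx.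
have mf_ n : measurable_fun setT (EFin \o f_ n) by exact/measurable_EFinP.
transitivity (limn (fun n => \int[mu']_x (f_ n x)%:E)).
  rewrite -monotone_convergence//.
    by apply: eq_integral => x _; apply/esym/cvg_lim => //; exact: f_cvg.
  by move=> n x _; rewrite lee_fin.
rewrite [X in limn X](_ : _ = fun n => \int[mu]_x ((f_ n x)%:E * w x)).
  rewrite -monotone_convergence//.
  - apply: eq_integral => x _; apply/cvg_lim => //.
    apply: cvgeZr => //; exact: f_cvg.
  - by move=> n; exact: emeasurable_funM (mf_ n) mw.
  - by move=> n x _; apply: mule_ge0 => //; rewrite lee_fin.
  - by move=> x _ m n mn; rewrite lee_wpmul2r//; exact: f_nd.
apply/funext => n; rewrite integralT_nnsfun sintegralE.
(* On a simple function, both sides are sums over its level sets. *)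
transitivity (\int[mu]_x \sum_(r \in range (f_ n))
    ((r * \1_(f_ n @^-1` [set r]) x)%:E * w x)); last first.
  apply: eq_integral => x _; rewrite [in RHS](fimfunE (f_ n)) -fsumEFin//.
  by rewrite !fsbig_finite//= ge0_sume_distrl// => r _; rewrite EFinM nnfun_muleindic_ge0.
rewrite ge0_integral_fsum//; last first.
- by move=> r x _; rewrite mule_ge0// EFinM nnfun_muleindic_ge0.
- move=> r; apply: emeasurable_funM => //; apply/measurable_EFinP.
  by apply: measurable_funM => //; exact: measurable_indic.
apply: eq_fsbigr => r; rewrite inE => -[x _ <-].
rewrite mu'E// integral_mkcond.
rewrite -ge0_integralZl_EFin//.
- apply: eq_integral => y _; rewrite EFinM -muleA; congr (_ * _).
  by rewrite patchE indicE; case: ifPn => yr; rewrite ?mul1e ?mul0e.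
- by move=> y _; rewrite patchE; case: ifP.
- by apply/(measurable_restrictT _ _).1 => //; exact: measurable_funTS.
Qed.

End density.

Section image_measure.
Context d1 d2 (T1 : measurableType d1) (T2 : measurableType d2) (R : realType).

(** The measure structure of [pushforward mu phi] depends on the measurability
    of [phi], which cannot be inferred from the set function. *)
Definition image_measure (mu : {measure set T1 -> \bar R}) (phi : T1 -> T2)
    (mphi : measurable_fun setT phi) : {measure set T2 -> \bar R} :=
  measure_function_pushforward__canonical__measure_function_Measure mu mphi.

End image_measure.

(** * Polynomial approximation of a step function *)

Section step_limit.
Context (R : realType).
Implicit Types (u x r : R).

(** Bernoulli's inequality. *)
Lemma ge_expr_1B x n : 0 <= x <= 1 -> 1 - n%:R * x <= (1 - x) ^+ n.
Proof.
move=> /andP[x0 x1]; elim: n => [|n IH]; first by rewrite mul0r subr0 expr0.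
rewrite exprS; apply: (@le_trans _ _ ((1 - x) * (1 - n%:R * x))).
  rewrite -natr1; have : 0 <= n%:R * x * x by rewrite !mulr_ge0.
  by nra.
by rewrite ler_wpM2l// subr_ge0.
Qed.

(** Bernoulli's inequality for [1 + x], as [(1 - x) (1 + x) <= 1]. *)
Lemma le_expr_1B x n : 0 <= x <= 1 -> (1 - x) ^+ n * (1 + n%:R * x) <= 1.
Proof.
move=> /andP[x0 x1]; elim: n => [|n IH]; first by rewrite mul0r addr0 expr0 mulr1.
apply: le_trans IH; rewrite exprS mulrAC mulrC ler_wpM2l//.
  by rewrite exprn_ge0// subr_ge0.
rewrite -natr1; have : 0 <= n%:R * x * x by rewrite !mulr_ge0.
by nra.
Qed.

(** [1 - r ^+ n] is [1 - r] times a sum of [n] powers, each at least [r ^+ n]. *)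
Lemma le_Mn_expr r n : 0 <= r <= 1 -> n%:R * (1 - r) * r ^+ n <= 1 - r ^+ n.
Proof.
move=> /andP[r0 r1]; elim: n => [|n IH]; first by rewrite !mul0r expr0 subrr.
have rn1 : r ^+ n <= 1 by rewrite exprn_ile1.
have rn0 : 0 <= r ^+ n by rewrite exprn_ge0.
rewrite exprS -natr1.
have := ler_wpM2l r0 IH.
have : 0 <= (1 - r) * (1 - r * r ^+ n).
  by rewrite mulr_ge0// subr_ge0// mulr_ile1.
by nra.
Qed.

Lemma cvg_Mn_expr r : 0 <= r < 1 -> n%:R * r ^+ n @[n --> \oo] --> (0 : R).
Proof.
move=> /andP[r0 r1].
(* With [r = s ^ 2], one factor [s ^ n] absorbs [n] and the other tends to 0. *)
pose s := Num.sqrt r.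
have s0 : 0 <= s by exact: sqrtr_ge0.
have rE : r = s ^+ 2 by rewrite sqr_sqrtr.
have s1 : s < 1 by rewrite -(ltr_pXn2r (n := 2))// ?nnegrE// -rE expr1n.
apply: (@squeeze_cvgr _ _ _ _ (fun=> 0) (geometric (1 - s)^-1 s)).
- apply: nearW => n; apply/andP; split; first by rewrite mulr_ge0// exprn_ge0.
  rewrite /geometric/= rE -exprM mulnC exprM expr2 mulrA.
  rewrite ler_wpM2r ?exprn_ge0// -[leRHS]mul1r ler_pdivlMr ?subr_gt0// mulrAC.
  apply: le_trans (le_Mn_expr _ _) _; first by rewrite s0 ltW.
  by rewrite gerBl exprn_ge0.
- exact: cvg_cst.
- by apply: cvg_geometric; rewrite ger0_norm.
Qed.

(** By Bernoulli, [(1 - u ^ n) ^ m] is close to 1 when [m u ^ n] is small and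
    close to 0 when it is large; here [m u ^ n = n (2 u) ^ n]. The factor [n]
    settles the case [u = 1/2]. *)
Definition step_approx (n : nat) (u : R) : R := (1 - u ^+ n) ^+ (n * 2 ^ n).

Lemma step_approx01 n u : 0 <= u <= 1 -> 0 <= step_approx n u <= 1.
Proof.
move=> /andP[u0 u1].
have h : 0 <= 1 - u ^+ n <= 1.
  by rewrite subr_ge0 exprn_ile1//= gerBl exprn_ge0.
by rewrite exprn_ge0 ?exprn_ile1//; case/andP: h.
Qed.

Lemma cvg_step_approx u : 0 <= u <= 1 ->
  step_approx n u @[n --> \oo] --> ((u < 2^-1)%R%:R : R).
Proof.
move=> u01; have /andP[u0 u1] := u01.
have un01 n : 0 <= u ^+ n <= 1 by rewrite exprn_ge0// exprn_ile1.
have mE n : (n * 2 ^ n)%:R * u ^+ n = n%:R * (2 * u) ^+ n.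
  by rewrite natrM natrX -mulrA -exprMn.
have [ult|uge] := ltP u 2^-1.
  have q01 : 0 <= 2 * u < 1 by apply/andP; split; lra.
  apply: (@squeeze_cvgr _ _ _ _ (fun n => 1 - n%:R * (2 * u) ^+ n) (fun=> 1)).
  - apply: nearW => n; rewrite -mE ge_expr_1B//=.
    by have /andP[] := step_approx01 n u01.
  - rewrite -[X in _ --> X]subr0; apply: cvgB; first exact: cvg_cst.
    exact: cvg_Mn_expr.
  - exact: cvg_cst.
apply: (@squeeze_cvgr _ _ _ _ (fun=> 0) (@harmonic R)).
- apply: nearW => n; have /andP[-> _ /=] := step_approx01 n u01.
  have := le_expr_1B (n * 2 ^ n) (un01 n); rewrite mE -/(step_approx n u) => h.
  rewrite /harmonic/= -[leRHS]mul1r ler_pdivlMr// (le_trans _ h)//.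
  rewrite ler_wpM2l ?(andP (step_approx01 n u01)).1//.
  rewrite -natr1 addrC lerD2l ler_peMr// exprn_ege1//; lra.
- exact: cvg_cst.
- exact: cvg_harmonic.
Qed.

End step_limit.

(** * Uniqueness of finite measures on a multiplicative class *)

Section multiplicative_uniqueness.
Context d (T : measurableType d) (R : realType).
Variables (mu1 mu2 : {measure set T -> \bar R}) (E : set (T -> R)).
Hypotheses (mu1_fin : (mu1 setT < +oo)%E) (mu2_fin : (mu2 setT < +oo)%E).
Hypotheses (mE : forall u, E u -> measurable_fun setT u)
  (E01 : forall u, E u -> forall x, 0 <= u x <= 1)
  (E1 : E (cst 1)) (EM : forall u v, E u -> E v -> E (u \* v)).
Hypothesis muE : forall u, E u ->
  (\int[mu1]_x (u x)%:E = \int[mu2]_x (u x)%:E)%E.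

(** The pairings are required for all [u] in [E], and not only for [u = 1], so
    that the class is stable under multiplication by the elements of [E]. *)
Let test (F : T -> R) := [/\ measurable_fun setT F, (forall x, 0 <= F x <= 1) &
  forall u, E u -> (\int[mu1]_x (F x * u x)%:E = \int[mu2]_x (F x * u x)%:E)%E].

Let bounded_integrable (mu : {measure set T -> \bar R}) (F : T -> R) :
  (mu setT < +oo)%E -> measurable_fun setT F -> (forall x, 0 <= F x <= 1) ->
  mu.-integrable setT (EFin \o F).
Proof.
move=> mufin mF F01; apply: measurable_bounded_integrable => //.
exists 1; split => // M M1 x _ /=; have /andP[F0 F1] := F01 x.
by rewrite ger0_norm// (le_trans F1)// ltW.
Qed.

Let mul01 (a b : R) : 0 <= a <= 1 -> 0 <= b <= 1 -> 0 <= a * b <= 1.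
Proof. by move=> /andP[a0 a1] /andP[b0 b1]; rewrite mulr_ge0// mulr_ile1. Qed.

Let test1 : test (cst 1).
Proof.
split => //; first by move=> x /=; rewrite ler01 lexx.
move=> u Eu; under eq_integral do rewrite mul1r.
by under [RHS]eq_integral do rewrite mul1r; exact: muE.
Qed.

Let testM F u : test F -> E u -> test (F \* u).
Proof.
move=> [mF F01 FE] Eu; split.
- by apply: measurable_funM => //; exact: mE.
- by move=> x; apply: mul01 => //; exact: E01.
- move=> v Ev; have := FE _ (EM Eu Ev).
  under eq_integral do rewrite mulrA.
  by under [in X in _ = X -> _]eq_integral do rewrite mulrA.
Qed.

Let testB F G : test F -> test G -> (forall x, G x <= F x) -> test (F \- G).
Proof.
move=> [mF F01 FE] [mG G01 GE] GF; split.
- exact: measurable_funB.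
- move=> x; have /andP[F0 F1] := F01 x; have /andP[G0 G1] := G01 x.
  by rewrite subr_ge0 GF/= lerBlDr (le_trans F1)// lerDl.
- move=> u Eu.
  have key (mu : {measure set T -> \bar R}) : (mu setT < +oo)%E ->
      (\int[mu]_x ((F \- G) x * u x)%:E =
       \int[mu]_x (F x * u x)%:E - \int[mu]_x (G x * u x)%:E)%E.
    move=> mufin; rewrite -integralB_EFin//.
    + by apply: eq_integral => x _; rewrite -EFinB -mulrBl.
    + apply: (@bounded_integrable mu (F \* u)) => //.
        by apply: measurable_funM => //; exact: mE.
      by move=> x; apply: mul01 => //; exact: E01.
    + apply: (@bounded_integrable mu (G \* u)) => //.
        by apply: measurable_funM => //; exact: mE.
      by move=> x; apply: mul01 => //; exact: E01.
  by rewrite !key// FE// GE.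
Qed.

Let test_lim (F_ : nat -> T -> R) F : (forall n, test (F_ n)) ->
  (forall x, F_ n x @[n --> \oo] --> F x) -> test F.
Proof.
move=> tF FF.
have mF : measurable_fun setT F.
  apply: (@measurable_fun_cvg _ _ _ _ F_) => [n|x _]; last exact: FF.
  by have [] := tF n.
have F01 x : 0 <= F x <= 1.
  have F_01 n : 0 <= F_ n x <= 1 by have [_ + _] := tF n; exact.
  rewrite -(cvg_lim (@Rhausdorff R) (FF x)); apply/andP; split.
    apply: limr_ge; first exact: cvgP (FF x).
    by apply: nearW => n; case/andP: (F_01 n).
  apply: limr_le; first exact: cvgP (FF x).
  by apply: nearW => n; case/andP: (F_01 n).
split => // u Eu.
have key (mu : {measure set T -> \bar R}) : (mu setT < +oo)%E ->
    (\int[mu]_x (F_ n x * u x)%:E @[n --> \oo] --> \int[mu]_x (F x * u x)%:E)%E.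
  move=> mufin.
  have int1 : mu.-integrable setT (EFin \o cst 1).
    by apply: bounded_integrable => // x /=; rewrite ler01 lexx.
  have [//|||//||//] := @dominated_convergence _ _ _ mu setT measurableT
      (fun n x => (F_ n x * u x)%:E) (fun x => (F x * u x)%:E) (EFin \o cst 1).
  - move=> n; apply/measurable_EFinP; apply: measurable_funM; last exact: mE.
    by have [] := tF n.
  - by apply/measurable_EFinP; apply: measurable_funM => //; exact: mE.
  - apply: aeW => x _; apply: cvg_EFin; first exact: nearW.
    by apply: cvgM; [exact: FF|exact: cvg_cst].
  - apply: aeW => x n _; rewrite /= lee_fin.
    have /andP[p q] : 0 <= F_ n x * u x <= 1.
      by apply: mul01; [have [_ + _] := tF n; exact|exact: E01].
    by rewrite ger0_norm.
apply: (cvg_unique _ (key _ mu1_fin)) => //.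
rewrite (_ : (fun n => _) = fun n => \int[mu2]_x (F_ n x * u x)%:E)%E.
  exact: key.
by apply/funext => n; have [_ _] := tF n; exact.
Qed.

Let EX u n : E u -> E (fun x => u x ^+ n).
Proof.
move=> Eu; elim: n => [|n IH].
  by rewrite (_ : (fun _ => _) = cst 1)//; apply/funext => x; rewrite expr0.
rewrite (_ : (fun _ => _) = u \* (fun x => u x ^+ n)); first exact: EM.
by apply/funext => x; rewrite exprS.
Qed.

Let test_1BX F u n : test F -> E u -> test (fun x => F x * (1 - u x) ^+ n).
Proof.
move=> tF Eu; elim: n => [|n IH].
  by under eq_fun do rewrite expr0 mulr1.
have := testB IH (testM IH Eu) _.
rewrite (_ : _ \- _ = fun x => F x * (1 - u x) ^+ n.+1); last first.
  by apply/funext => x /=; rewrite exprSr mulrA mulrBr mulr1.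
apply=> x /=; have [_ /(_ x)/andP[h _] _] := IH.
by have /andP[_ ?] := E01 Eu x; rewrite ler_piMr.
Qed.

Let test_step F u : test F -> E u -> test (F \* \1_[set x | u x < 2^-1]).
Proof.
move=> tF Eu.
apply: (@test_lim (fun n x => F x * step_approx n (u x))).
  by move=> n; exact: test_1BX (EX n Eu).
move=> x /=; rewrite indicE mem_setE; apply: cvgM; first exact: cvg_cst.
by apply: cvg_step_approx; exact: E01.
Qed.

(** The sets [B] such that multiplication by the indicator of [B] preserves the
    test functions form a sigma-algebra: intersections correspond to composing
    two multiplications. It contains the sets [u < 1/2], by passing to the limit
    in [step_approx]. *)
Lemma multiplicative_uniqueness (A : set T) :
  <<s [set [set x | u x < 2^-1] | u in E] >> A -> mu1 A = mu2 A.
Proof.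
pose stable B := measurable B /\ forall F, test F -> test (F \* \1_B).
suff : <<s [set [set x | u x < 2^-1] | u in E] >> `<=` stable.
  move=> + sA => /(_ _ sA)[mA /(_ _ test1)[_ _ /(_ _ E1)]].
  have key (mu : {measure set T -> \bar R}) :
      (\int[mu]_x ((cst 1 \* \1_A) x * cst 1 x)%:E = mu A)%E.
    under eq_integral do rewrite /= mul1r mulr1.
    by rewrite integral_indic// setIT.
  by rewrite !key.
have stableI B C : stable B -> stable C -> stable (B `&` C).
  move=> [mB sB] [mC sC]; split; first exact: measurableI.
  move=> F /sB/sC; rewrite (_ : _ \* _ = F \* \1_(B `&` C))//.
  by apply/funext => x /=; rewrite indicI mulrA.
have stableC B : stable B -> stable (~` B).
  move=> [mB sB]; split; first exact: measurableC.
  move=> F tF; have := testB tF (sB _ tF) _.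
  rewrite (_ : _ \- _ = F \* \1_(~` B)).
    apply => x /=; have [_ /(_ x)/andP[h _] _] := tF.
    by rewrite ler_piMr// indicE; case: (_ \in _).
  apply/funext => x /=; rewrite !indicE in_setC.
  by case: (_ \in _); rewrite ?mulr1 ?mulr0 ?subrr ?subr0.
have stableU B C : stable B -> stable C -> stable (B `|` C).
  by move=> sB sC; rewrite -[B `|` C]setCK setCU; apply/stableC/stableI; exact: stableC.
have stable0 : stable set0.
  split => // F tF; apply: (@test_lim (fun n => F \- F)) => [n|x].
    exact: testB.
  by rewrite /= indic0 mulr0 subrr; exact: cvg_cst.
apply: smallest_sub; last first.
  move=> _ [u Eu <-]; split; last by move=> F tF; exact: test_step.
  rewrite -[X in measurable X]setTI.
  rewrite (_ : [set x | _] = u @^-1` `]-oo, 2^-1[%classic); first exact: mE.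
  by apply/seteqP; split => x /=; rewrite in_itv.
split => //.
- by move=> B; rewrite setTD; exact: stableC.
- move=> B sB; split; first by apply: bigcup_measurable => n _; have [] := sB n.
  have sU n : stable (\big[setU/set0]_(i < n) B i).
    by elim/big_ind: _.
  move=> F tF; apply: (@test_lim (fun n => F \* \1_(\big[setU/set0]_(i < n) B i))).
    by move=> n; have [_] := sU n; exact.
  move=> x /=; apply: cvgM; first exact: cvg_cst.
  rewrite !indicE; have [|nB] := boolP (x \in \bigcup_n B n).
    rewrite inE => -[n _ Bnx]; apply: cvg_near_cst; exists n.+1 => // m /= nm.
    rewrite indicE (_ : x \in _ = true)//; apply/mem_set; rewrite -bigcup_mkord.
    by exists n.
  apply: cvg_near_cst; apply: nearW => n.
  rewrite indicE (_ : x \in _ = false)//; apply/negbTE; apply: contra nB.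
  by rewrite !inE -bigcup_mkord => -[i _ Bix]; exists i.
Qed.

End multiplicative_uniqueness.

(** * The extended exponential *)

Lemma measurable_expeR (R : realType) : measurable_fun setT (@expeR R).
Proof.
apply: (measurability _ (ErealGenOInfty.measurableE R)) => _ [_ [r ->] <-].
rewrite setTI; have [r0|r0] := ltP r 0.
  rewrite (_ : _ @^-1` _ = setT)//; apply/seteqP; split => x //= _.
  by rewrite in_itv/= andbT (lt_le_trans _ (expeR_ge0 x))// lte_fin.
have [y yr] := @expeR_total R r%:E r0.
rewrite (_ : _ @^-1` _ = `]y, +oo[%classic); first exact: emeasurable_itv.
by apply/seteqP; split => x; rewrite /= !in_itv/= !andbT -yr lte_expeR.
Qed.

Lemma cvg_expeRN (R : realType) (u : nat -> \bar R) (l : \bar R) : (0 <= l)%E ->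
  u n @[n --> \oo] --> l -> expeR (- u n)%E @[n --> \oo] --> expeR (- l)%E.
Proof.
case: l => [r _|_|//].
- move=> /fine_cvgP[ufin ur].
  have : (expR (- fine (u n)))%:E @[n --> \oo] --> (expR (- r))%:E.
    apply: cvg_EFin; first exact: nearW.
    apply: (@continuous_cvg _ _ _ _ _ (fun n => (- fine (u n))%R) expR).
      exact: continuous_expR.
    exact: cvgN.
  apply: cvg_trans; apply: near_eq_cvg.
  by near=> n; rewrite -[in RHS](@fineK _ (u n))//; near: n.
- move=> /cvgeyPgtr uoo; apply/fine_cvgP; split.
    near=> n; have : (0%:E < u n)%E by near: n; apply: uoo; exact: num_real.
    by case: (u n).
  apply/cvgr0Pnorm_lt => e e0.
  have small (y : \bar R) : ((- ln e)%:E < y)%E -> `|fine (expeR (- y))| < e.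
    case: y => [r| |]//=; last by rewrite normr0.
    rewrite lte_fin ltrNl => rlne; rewrite ger0_norm ?expR_ge0//.
    by rewrite -[ltRHS]lnK// ltr_expR.
  by near=> n; apply: small; near: n; apply: uoo; exact: num_real.
Unshelve. all: by end_near. Qed.

(** * Laplace functionals on the cone *)

Section laplace.
Context d (X : measurableType d) (R : realType).
Implicit Types (f g h : X -> R) (eta : Dplus X R).

(** The integrand of the Laplace functional. It is extended real valued so that
    it vanishes exactly where the integral of [f] is infinite. *)
Definition expN_int f eta : \bar R := expeR (- \int[eta]_x (f x)%:E)%E.

Let int_ge0 f eta : (forall x, 0 <= f x) -> (0 <= \int[eta]_x (f x)%:E)%E.
Proof. by move=> f0; apply: integral_ge0 => x _; rewrite lee_fin. Qed.

Lemma expN_int_ge0 f eta : (0 <= expN_int f eta)%E.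
Proof. exact: expeR_ge0. Qed.

Lemma expN_int_le1 f eta : (forall x, 0 <= f x) -> (expN_int f eta <= 1)%E.
Proof. by move=> f0; rewrite -expeR0 lee_expeR leeNl oppe0; exact: int_ge0. Qed.

Lemma expN_int_fin_num f eta : (forall x, 0 <= f x) -> expN_int f eta \is a fin_num.
Proof.
move=> f0; rewrite ge0_fin_numE ?expN_int_ge0//.
by rewrite (le_lt_trans (expN_int_le1 _ f0))// ltry.
Qed.

Lemma expN_intD f g eta : measurable_fun setT f -> measurable_fun setT g ->
  (forall x, 0 <= f x) -> (forall x, 0 <= g x) ->
  expN_int (f \+ g) eta = (expN_int f eta * expN_int g eta)%E.
Proof.
move=> mf mg f0 g0; rewrite /expN_int -expeRD; congr expeR.
under eq_integral do rewrite EFinD.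
rewrite ge0_integralD//; try (by move=> x _; rewrite lee_fin);
  try exact/measurable_EFinP.
by rewrite oppeD// ge0_adde_def// inE int_ge0.
Qed.

Lemma measurable_expN_int f : measurable_fun setT f -> (forall x, 0 <= f x) ->
  measurable_fun setT (expN_int f).
Proof.
move=> mf f0; apply: (measurableT_comp (@measurable_expeR R)).
apply: measurableT_comp => //; apply: measurable_Dplus_integral.
  exact/measurable_EFinP.
by move=> x; rewrite lee_fin.
Qed.

(** The scaling of the indicator moves the threshold of [eta A] to the fixed
    threshold [1/2]. *)
Lemma expN_int_indic_lt (A : set X) (y : R) eta : measurable A -> 0 < y ->
  (expN_int (fun x => ln 2 / y * \1_A x)%R eta < 2^-1%:E)%E = (y%:E < eta A)%E.
Proof.
move=> mA y0; rewrite /expN_int.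
have c0 : 0 < ln 2 / y :> R by rewrite divr_gt0// ln_gt0// ltr1n.
under eq_integral do rewrite EFinM.
rewrite ge0_integralZl_EFin//; last 2 first.
- exact/measurable_EFinP.
- exact: ltW.
have -> : (\int[eta]_x (\1_A x)%:E = (fine (eta A))%:E)%E.
  by rewrite integral_indic// setIT fineK// fin_num_measure.
have <- : ((fine (eta A))%:E = eta A)%E by rewrite fineK// fin_num_measure.
set m := fine _.
rewrite -EFinM -EFinN /= !lte_fin -[ltRHS]lnK ?posrE ?invr_gt0//.
rewrite ltr_expR lnV ?posrE// ltrN2 mulrAC ltr_pdivlMr//.
by rewrite ltr_pM2l// ln_gt0// ltr1n.
Qed.

Definition bounded_test : set (X -> R) := [set h : X -> R | [/\ measurable_fun setT h,
  forall x, 0 <= h x & exists C, forall x, h x <= C]].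

(** The functions [expN_int h] form a multiplicative class, and their sublevel sets
    at [1/2] include the sets [y < eta A] with [0 < y], which generate the
    sigma-algebra of the cone. *)
Lemma eq_measure_Dplus (mu1 mu2 : {measure set (Dplus X R) -> \bar R}) :
  (mu1 setT < +oo)%E -> (mu2 setT < +oo)%E ->
  (forall h, bounded_test h ->
    \int[mu1]_eta expN_int h eta = \int[mu2]_eta expN_int h eta)%E ->
  forall B, measurable B -> mu1 B = mu2 B.
Proof.
move=> fin1 fin2 muE B mB.
pose E : set (Dplus X R -> R) := [set fine \o expN_int h | h in bounded_test].
have EE h eta : bounded_test h -> (fine (expN_int h eta))%:E = expN_int h eta.
  by move=> [_ h0 _]; rewrite fineK// expN_int_fin_num.
apply: (@multiplicative_uniqueness _ _ _ _ _ E) => //.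
- move=> _ [h [mh h0 _] <-]; apply: measurableT_comp => //.
  exact: measurable_expN_int.
- move=> _ [h bh <-] eta /=; have [_ h0 _] := bh.
  by rewrite -!lee_fin EE// expN_int_ge0 expN_int_le1.
- exists (cst 0); first by split => //; exists 0 => x.
  by apply/funext => eta; rewrite /= /expN_int integral0 oppe0 expeR0.
- move=> _ _ [h bh <-] [k bk <-]; have [mh h0 [C hC]] := bh; have [mk k0 [D kD]] := bk.
  have bhk : bounded_test (h \+ k).
    split; first exact: measurable_funD.
      by move=> x; rewrite addr_ge0.
    by exists (C + D) => x; rewrite lerD.
  exists (h \+ k) => //; apply/funext => eta; apply: EFin_inj => /=.
  by rewrite EFinM !EE// expN_intD.
- move=> _ [h bh <-]; under eq_integral do rewrite /= EE//.
  by under [RHS]eq_integral do rewrite /= EE//; exact: muE.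
set G := [set [set x | u x < 2^-1] | u in E].
have mG (A : set X) (y : R) : measurable A -> 0 < y ->
    <<s G >> [set eta : Dplus X R | y%:E < eta A]%E.
  move=> mA y0; apply: sub_gen_smallest.
  have c0 : 0 <= ln 2 / y :> R by rewrite divr_ge0// ?ltW// ln_gt0// ltr1n.
  have bh : bounded_test (fun x => ln 2 / y * \1_A x).
    split.
    - by apply: measurable_funM.
    - by move=> x; rewrite mulr_ge0.
    - by exists (ln 2 / y) => x; rewrite ler_piMr// indicE; case: (_ \in _).
  exists (fine \o expN_int (fun x => ln 2 / y * \1_A x)).
    by exists (fun x => ln 2 / y * \1_A x).
  by apply/seteqP; split => eta /=; rewrite -lte_fin EE// expN_int_indic_lt.
move: B mB; apply: smallest_sub; first exact: smallest_sigma_algebra.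
move=> _ [A mA [C mC <-]].
pose DG := g_sigma_algebraType G.
suff : measurable_fun setT (fun eta : DG => (eta : Dplus X R) A) by move=> /(_ measurableT _ mC).
apply: (measurability _ (ErealGenOInfty.measurableE R)) => _ [_ [y ->] <-].
rewrite setTI.
have [y0|y0] := ltP 0 y.
  rewrite (_ : _ @^-1` _ = [set eta : Dplus X R | y%:E < eta A]%E); first exact: mG.
  by apply/seteqP; split=> eta /=; rewrite in_itv/= andbT.
move: y0; rewrite le_eqVlt => /predU1P[->|y0]; last first.
  rewrite (_ : _ @^-1` _ = setT)//; apply/seteqP; split => eta //= _.
  by rewrite in_itv/= andbT (@lt_le_trans _ _ 0%E)// lte_fin.
(* The scaling needs a positive threshold, so 0 is reached from above. *)
rewrite (_ : _ @^-1` _ =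
    \bigcup_n [set eta : Dplus X R | (n.+1%:R^-1)%:E < eta A]%E).
  by apply: bigcup_measurable => n _; exact: mG.
apply/seteqP; split=> eta /=; rewrite in_itv/= andbT.
  have etaAE : ((fine (eta A))%:E = eta A)%E by rewrite fineK// fin_num_measure.
  rewrite -etaAE lte_fin => e0.
  have [n /= _ /(_ n (leqnn n)) ne] := near_infty_natSinv_lt (PosNum e0).
  by exists n => //=; rewrite -etaAE lte_fin.
by move=> [n _ /=]; apply: lt_trans; rewrite lte_fin invr_gt0.
Qed.

End laplace.

(** * The gamma measure *)

Lemma cvg_minr_nat (R : realType) (r : R) : Num.min r n%:R @[n --> \oo] --> r.
Proof.
apply: cvg_near_cst; near=> n; apply/min_idPl; near: n.
exact: nbhs_infty_ger.
Unshelve. all: by end_near. Qed.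

Section gamma.
Context d (X : measurableType d) (R : realType)
  (nu : {finite_measure set X -> \bar R}) (P : probability (Dplus X R) R).
Hypothesis P_gamma : is_gamma_measure nu P.
Implicit Types (f h : X -> R).

Lemma gamma_laplace_bounded h : bounded_test h ->
  (\int[P]_eta expN_int h eta = expeR (- \int[nu]_x (ln (1 + h x))%:E))%E.
Proof.
move=> [mh h0 [C hC]]; have := P_gamma mh h0 (ex_intro _ C hC).
have bint (mu : {finite_measure set X -> \bar R}) (g : X -> R) D :
    measurable_fun setT g -> (forall x, 0 <= g x <= D) ->
    (\int[mu]_x (g x)%:E = (\int[mu]_x g x)%:E)%E.
  move=> mg gD; rewrite /Rintegral fineK//.
  rewrite ge0_fin_numE; last first.
    by apply: integral_ge0 => x _; rewrite lee_fin; have /andP[] := gD x.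
  apply: (@le_lt_trans _ _ (\int[mu]_x D%:E)%E).
    apply: ge0_le_integral => //.
    - by move=> x _; rewrite lee_fin; have /andP[] := gD x.
    - exact/measurable_EFinP.
    - by move=> x _; rewrite lee_fin; have /andP[] := gD x.
  rewrite integral_cst// lte_mul_pinfty//.
  + by rewrite lee_fin; have /andP[g0 gD'] := gD point; exact: le_trans gD'.
  + by rewrite -ge0_fin_numE// fin_num_measure.
rewrite unlock (bint nu (fun x => ln (1 + h x)) (ln (1 + C))).
- rewrite -EFinN [expeR _]/= => <-; apply: eq_integral => eta _; rewrite /expN_int (bint _ _ C)//.
  by move=> x; rewrite h0 hC.
- by apply: measurableT_comp => //; exact: measurable_funD.
- move=> x; rewrite ln_ge0 ?lerDl//= ler_ln ?posrE ?lerD2l// ltr_pwDl//.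
  exact: le_trans (hC x).
Qed.

(** Truncation: the integrands decrease and are bounded by 1, and the exponents
    increase. When [ln (1 + f)] is not summable both sides are 0. *)
Lemma gamma_laplace f : measurable_fun setT f -> (forall x, 0 <= f x) ->
  (\int[P]_eta expN_int f eta = expeR (- \int[nu]_x (ln (1 + f x))%:E))%E.
Proof.
move=> mf f0; pose f_ n x := Num.min (f x) n%:R.
have mf_ n : measurable_fun setT (f_ n) by exact: measurable_minr.
have f_0 n x : 0 <= f_ n x by rewrite le_min f0 ler0n.
have bf n : bounded_test (f_ n).
  by split => //; exists n%:R => x; rewrite ge_min lexx orbT.
have f_f x : f_ n x @[n --> \oo] --> f x by exact: cvg_minr_nat.
have ndf x : {homo f_ ^~ x : m n / (m <= n)%N >-> m <= n}.
  by move=> m n mn; rewrite /f_ le_min2// ler_nat.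
have lnf0 x : 0 <= ln (1 + f x) by rewrite ln_ge0// lerDl.
have cvg_int (mu : {measure set X -> \bar R}) (g : X -> R) (g_ : nat -> X -> R) :
    measurable_fun setT g -> (forall n, measurable_fun setT (g_ n)) ->
    (forall n x, 0 <= g_ n x) -> (forall x, g_ n x @[n --> \oo] --> g x) ->
    (forall x, {homo g_ ^~ x : m n / (m <= n)%N >-> m <= n}) ->
    (\int[mu]_x (g_ n x)%:E @[n --> \oo] --> \int[mu]_x (g x)%:E)%E.
  move=> mg mg_ g0 gg nd.
  have gE x : limn (fun n => (g_ n x)%:E) = (g x)%:E.
    by apply/cvg_lim => //; apply: cvg_EFin; [exact: nearW|exact: gg].
  under [X in _ --> X]eq_integral do rewrite -gE.
  apply: cvg_monotone_convergence => //.
  - by move=> n; exact/measurable_EFinP.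
  - by move=> n x _; rewrite lee_fin.
  - by move=> x _ m n mn; rewrite lee_fin; exact: nd.
have L : (\int[P]_eta expN_int (f_ n) eta @[n --> \oo] -->
          \int[P]_eta expN_int f eta)%E.
  have := @dominated_convergence _ _ _ P setT measurableT
      (fun n => expN_int (f_ n)) (expN_int f) (cst 1%E).
  case=> //.
  - by move=> n; exact: measurable_expN_int.
  - exact: measurable_expN_int.
  - apply: aeW => eta _; apply: cvg_expeRN; last exact: cvg_int.
    by apply: integral_ge0 => x _; rewrite lee_fin.
  - exact: finite_measure_integrable_cst.
  - apply: aeW => eta n _; rewrite gee0_abs ?expN_int_ge0//.
    exact: expN_int_le1.
apply: (cvg_unique _ L) => //.
rewrite (_ : (fun n => _) =
    fun n => expeR (- \int[nu]_x (ln (1 + f_ n x))%:E)%E); last first.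
  by apply/funext => n; rewrite gamma_laplace_bounded.
apply: cvg_expeRN; first by apply: integral_ge0 => x _; rewrite lee_fin.
apply: cvg_int => //.
- by apply: measurableT_comp => //; exact: measurable_funD.
- by move=> n; apply: measurableT_comp => //; exact: measurable_funD.
- by move=> n x; rewrite ln_ge0// lerDl.
- move=> x; apply: (@continuous_cvg _ _ _ _ _ (fun n => 1 + f_ n x) (@ln R)).
    by apply: continuous_ln; rewrite ltr_pwDl.
  by apply: cvgD; [exact: cvg_cst|exact: f_f].
- by move=> x m n mn; rewrite ler_ln ?posrE ?ltr_pwDl// lerD2l; exact: ndf.
Qed.

(** The Laplace functional at [f / n] is at most the probability that [eta(f)] is
    finite, and it tends to 1. *)
Lemma gamma_ae_finite (f : X -> R) : measurable_fun setT f -> (forall x, 0 <= f x) ->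
  (\int[nu]_x (ln (1 + f x))%:E < +oo)%E ->
  {ae P, forall eta : Dplus X R, \int[eta]_x (f x)%:E < +oo}%E.
Proof.
move=> mf f0 lnf.
pose N := [set eta : Dplus X R | (\int[eta]_x (f x)%:E < +oo)%E].
have mI : measurable_fun setT (fun eta : Dplus X R => (\int[eta]_x (f x)%:E)%E).
  apply: measurable_Dplus_integral; first exact/measurable_EFinP.
  by move=> x; rewrite lee_fin.
have mN : measurable N.
  by rewrite -[N]setTI; exact: emeasurable_fun_infty_o.
have lnf0 x : 0 <= ln (1 + f x) by rewrite ln_ge0// lerDl.
pose f_ n x := n.+1%:R^-1 * f x.
have f_0 n x : 0 <= f_ n x by rewrite mulr_ge0.
have mf_ n : measurable_fun setT (f_ n) by exact: measurable_funM.
have mln (g : X -> R) : measurable_fun setT g ->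
    measurable_fun setT (fun x => (ln (1 + g x))%:E).
  move=> mg; apply/measurable_EFinP; apply: measurableT_comp => //.
  exact: measurable_funD.
have f_f n x : f_ n x <= f x by rewrite ler_piMl// invf_le1// ler1n.
have PN n : (expeR (- \int[nu]_x (ln (1 + f_ n x))%:E) <= P N)%E.
  rewrite -gamma_laplace// -[in leRHS](setIT N).
  rewrite -integral_indic//; apply: ge0_le_integral => //.
  - by move=> eta _; exact: expN_int_ge0.
  - exact: measurable_expN_int.
  - exact/measurable_EFinP.
  - move=> eta _; rewrite indicE; have [|] := boolP (eta \in N).
      by move=> _; exact: expN_int_le1.
    rewrite notin_setE /N/= => /negP; rewrite -leNgt leye_eq => /eqP foo.
    rewrite /expN_int /f_; under eq_integral do rewrite EFinM.
    rewrite ge0_integralZl_EFin//.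
    - by rewrite foo mulry gtr0_sg ?mul1e.
    - by move=> x _; rewrite lee_fin.
    - exact/measurable_EFinP.
have L : (\int[nu]_x (ln (1 + f_ n x))%:E @[n --> \oo] --> 0)%E.
  rewrite -(integral0 nu setT).
  have := @dominated_convergence _ _ _ nu setT measurableT
      (fun n x => (ln (1 + f_ n x))%:E) (cst 0%E) (fun x => (ln (1 + f x))%:E).
  case=> //.
  - by move=> n; exact: mln.
  - apply: aeW => x _; apply: cvg_EFin; first exact: nearW.
    rewrite -[X in _ --> X](@ln1 R).
    apply: (@continuous_cvg _ _ _ _ _ (fun n => 1 + f_ n x) (@ln R)).
      exact: continuous_ln.
    rewrite -[X in _ --> X]addr0; apply: cvgD; first exact: cvg_cst.
    rewrite -[X in _ --> X](mul0r (f x)); apply: cvgM; last exact: cvg_cst.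
    exact: cvg_harmonic.
  - apply/integrableP; split; first exact: mln.
    by under eq_integral do rewrite gee0_abs ?lee_fin//.
  - apply: aeW => x n _; rewrite gee0_abs ?lee_fin ?ln_ge0 ?lerDl//.
    by rewrite ler_ln ?posrE ?ltr_pwDl// lerD2l.
have PN1 : P N = 1%E.
  apply/eqP; rewrite eq_le probability_le1//=.
  have := cvg_expeRN (lexx 0%E) L; rewrite oppe0 expeR0 => cv.
  rewrite -(cvg_lim _ cv)//; apply: lime_le; first exact: cvgP cv.
  exact: nearW.
exists (~` N); split => //; first exact: measurableC.
by have := probability_setC P mN; rewrite PN1 subee.
Qed.

(** The Laplace functional at the indicator of [A] is 1, the largest value of its
    integrand. *)
Lemma gamma_ae_null (A : set X) : measurable A -> nu A = 0%E ->
  {ae P, forall eta : Dplus X R, eta A = 0%E}.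
Proof.
move=> mA nuA.
have ind0 x : 0 <= \1_A x :> R by [].
have u0 eta := expN_int_ge0 (X := X) (R := R) \1_A eta.
have u1 (eta : Dplus X R) := expN_int_le1 eta ind0.
have mu : measurable_fun setT (expN_int (X := X) (R := R) \1_A).
  exact: measurable_expN_int.
have Eu : (\int[P]_eta expN_int (X := X) (R := R) \1_A eta = 1)%E.
  rewrite gamma_laplace//.
  rewrite (_ : \int[nu]_x (ln (1 + \1_A x))%:E = 0)%E ?oppe0 ?expeR0//.
  transitivity (\int[nu]_(x in A) (ln 2)%:E)%E; last by rewrite integral_cst// [X in (_ * X)%E]nuA mule0.
  rewrite [RHS]integral_mkcond; apply: eq_integral => x _.
  by rewrite patchE indicE; case: ifPn => _ //; rewrite addr0 ln1.
have : (\int[P]_eta (1 - expN_int (X := X) (R := R) \1_A eta) = 0)%E.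
  have : (\int[P]_eta (1 - expN_int (X := X) (R := R) \1_A eta) + 1 = 1)%E.
    rewrite -[X in (_ + X)%E]Eu -ge0_integralD//.
    - under eq_integral => eta _ do rewrite subeK ?expN_int_fin_num//.
      rewrite integral_cst// mul1e; exact: probability_setT.
    - by move=> eta _; rewrite sube_ge0// expN_int_fin_num.
    - exact: emeasurable_funB.
  by move=> S1; rewrite -[LHS](@addeK _ 1%E)// S1 subee.
move=> E0; have : (\int[P]_eta `|1 - expN_int (X := X) (R := R) \1_A eta| = 0)%E.
  rewrite -[RHS]E0; apply: eq_integral => eta _.
  by rewrite gee0_abs// sube_ge0// expN_int_fin_num.
move/ae_eq_integral_abs => /(_ measurableT (emeasurable_funB (measurable_cst _) mu)).
apply: filterS => eta /(_ I) /= u_1.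
have : expN_int \1_A eta = 1%E.
  by rewrite -(@subeK _ 1%E (expN_int \1_A eta)) ?expN_int_fin_num// u_1 add0e.
rewrite -expeR0 /expN_int => /expeR_inj/eqP; rewrite oppe_eq0 => /eqP.
by rewrite integral_indic// setIT.
Qed.

End gamma.

(** * The weights *)

Section excess.
Context (R : realType).
Implicit Types r : R.

(** With [r^-1 = 0] at [r = 0], [1 + excess r^-1] is [max (1, 1/r)] for [r > 0] and
    1 at [r = 0]. *)
Definition excess r : R := Num.max (r - 1) 0.

Lemma excess_ge0 r : 0 <= excess r.
Proof. by rewrite /excess le_max lexx orbT. Qed.

Lemma measurable_excess d (X : measurableType d) (f : X -> R) :
  measurable_fun setT f -> measurable_fun setT (excess \o f).
Proof.
move=> mf; apply: measurable_maxr => //; exact: measurable_funB.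
Qed.

Lemma excess_le r : 0 <= r -> excess r <= r.
Proof. by move=> r0; rewrite /excess ge_max r0 gerBl ler01. Qed.

Lemma one_add_excessE r : 1 + excess r = Num.max r 1.
Proof. by rewrite /excess addr_maxr addr0 addrC subrK. Qed.

Lemma one_add_excess r : 0 < r -> 1 + excess r = r * (1 + excess r^-1).
Proof.
move=> r0; rewrite !one_add_excessE maxr_pMr ?ltW// mulfV ?gt_eqF// mulr1.
by rewrite maxC.
Qed.

Lemma ln_one_add_le r : 0 < r -> ln (1 + r) <= ln 2 + `|ln r|.
Proof.
move=> r0; have [r1|r1] := leP r 1.
  apply: (@le_trans _ _ (ln 2)); last by rewrite lerDl.
  by rewrite ler_ln ?posrE//; lra.
rewrite ger0_norm; last by rewrite ln_ge0// ltW.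
by rewrite -lnM ?posrE// ler_ln ?posrE//; lra.
Qed.

Lemma ln_one_add_excessV_le r : 0 < r -> ln (1 + excess r^-1) <= `|ln r|.
Proof.
move=> r0; rewrite one_add_excessE.
have [r1|r1] := leP r^-1 1; first by rewrite ln1.
by rewrite lnV ?posrE// -normrN ler_norm.
Qed.

End excess.

Section log_summable.
Context d (X : measurableType d) (R : realType)
  (nu : {finite_measure set X -> \bar R}) (a : X -> {nonneg R}).
Hypothesis a_log : log_summable nu a.

Let ma : measurable_fun setT (fun x => (a x)%:num).
Proof. by have [] := a_log. Qed.

Lemma measurable_lne_num : measurable_fun setT (fun x => lne (a x)%:num%:E).
Proof.
rewrite (_ : (fun _ => _) =
    fun x => if 0 < (a x)%:num then (ln (a x)%:num)%:E else -oo%E).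
  apply: measurable_fun_ifT => //; first exact: measurable_fun_ltr.
  by apply/measurable_EFinP; exact: measurableT_comp.
by apply/funext => x; rewrite /= leNgt; case: (0 < _).
Qed.

Lemma integrable_lne : nu.-integrable setT (fun x => lne (a x)%:num%:E).
Proof.
apply/integrableP; split; first exact: measurable_lne_num.
by have [] := a_log.
Qed.

(** At the zeros of [a], [lne] is infinite. *)
Lemma log_summable_gt0 : {ae nu, forall x, 0 < (a x)%:num}.
Proof.
have := integrable_ae measurableT integrable_lne.
by apply: filterS => x /(_ I); rewrite /= leNgt; case: (0 < _).
Qed.

Let measurable_ln1 (f : X -> R) : measurable_fun setT f ->
  measurable_fun setT (fun x => (ln (1 + f x))%:E).
Proof.
move=> mf; apply/measurable_EFinP; apply: measurableT_comp => //.
exact: measurable_funD.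
Qed.

(** The dominating function is [C + `|lne a|], which is infinite at the zeros
    of [a]. *)
Let ln1_lty (f : X -> R) (C : R) : measurable_fun setT f -> (forall x, 0 <= f x) ->
  (forall x, 0 < (a x)%:num -> ln (1 + f x) <= C + `|ln (a x)%:num|) ->
  0 <= C -> (\int[nu]_x (ln (1 + f x))%:E < +oo)%E.
Proof.
move=> mf f0 fC C0; apply: (@le_lt_trans _ _
    (\int[nu]_x (C%:E + `|lne (a x)%:num%:E|))%E).
  apply: ge0_le_integral => //.
  - by move=> x _; rewrite lee_fin ln_ge0// lerDl.
  - exact: measurable_ln1.
  - apply: emeasurable_funD => //; apply: measurableT_comp => //.
    exact: measurable_lne_num.
  - move=> x _; have [a0|] := ltP 0 (a x)%:num.
      by rewrite lne_EFin//= lee_fin fC.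
    by move=> a0; rewrite /= a0 /= addey// leey.
rewrite ge0_integralD//; last by apply: measurableT_comp => //; exact: measurable_lne_num.
rewrite lte_add_pinfty//; last by have [] := a_log.
rewrite integral_cst// lte_mul_pinfty// -ge0_fin_numE//.
exact: fin_num_measure.
Qed.

Lemma ln_one_add_lty : (\int[nu]_x (ln (1 + (a x)%:num))%:E < +oo)%E.
Proof.
apply: (@ln1_lty (fun x => (a x)%:num) (ln 2)) => //.
  by move=> x; exact: ln_one_add_le.
by rewrite ln_ge0// ler1n.
Qed.

Lemma measurable_inv_num : measurable_fun setT (fun x => ((a x)%:num)^-1).
Proof.
rewrite (_ : (fun _ => _) = fun x => (a x)%:num `^ (-1)).
  exact: (measurableT_comp (measurable_powR (-1))).
by apply/funext => x; rewrite powR_inv1.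
Qed.

Let b x := excess ((a x)%:num)^-1.

Let mb : measurable_fun setT b.
Proof. exact: measurable_excess measurable_inv_num. Qed.

Lemma ln_one_add_excessV_lty :
  (\int[nu]_x (ln (1 + excess ((a x)%:num)^-1))%:E < +oo)%E.
Proof.
apply: (@ln1_lty b 0) => // [x|x a0]; first exact: excess_ge0.
by rewrite add0r; exact: ln_one_add_excessV_le.
Qed.

(** This is [log (a g) = log a + log g] for [g = max (1, 1/a) + h]. *)
Lemma integral_ln_one_add_mul (h : X -> R) : bounded_test h ->
  (\int[nu]_x (ln (1 + ((a x)%:num * h x + excess (a x)%:num)))%:E =
   \int[nu]_x lne (a x)%:num%:E +
   \int[nu]_x (ln (1 + (h x + excess ((a x)%:num)^-1)))%:E)%E.
Proof.
move=> [mh h0 [C hC]].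
have mhb : measurable_fun setT (fun x => h x + b x) by exact: measurable_funD.
have hb0 x : 0 <= h x + b x by rewrite addr_ge0// excess_ge0.
have lnhb0 x : (0 <= (ln (1 + (h x + b x)))%:E)%E by rewrite lee_fin ln_ge0// lerDl.
have C0 : 0 <= C by apply: le_trans (hC point).
rewrite -integralD//; last 2 first.
- exact: integrable_lne.
- apply/integrableP; split; first exact: measurable_ln1.
  under eq_integral do rewrite gee0_abs//.
  apply: (@ln1_lty (fun x => h x + b x) (ln (1 + C))) => //.
    move=> x a0; apply: (@le_trans _ _ (ln ((1 + C) * (1 + b x)))).
      rewrite ler_ln ?posrE ?mulr_gt0 ?ltr_pwDl// ?excess_ge0//.
      have := excess_ge0 ((a x)%:num)^-1; have := hC x; rewrite -/(b x).
      by nra.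
    rewrite lnM ?posrE ?ltr_pwDl ?excess_ge0// lerD2l.
    exact: ln_one_add_excessV_le.
  by rewrite ln_ge0// lerDl.
apply: ae_eq_integral => //.
- apply: measurable_ln1; apply: measurable_funD.
    exact: measurable_funM.
  exact: measurable_excess.
- by apply: emeasurable_funD; [exact: measurable_lne_num|exact: measurable_ln1].
(* Where [a > 0], the identity is [1 + a h + excess a = a (1 + h + excess a^-1)]. *)
apply: filterS log_summable_gt0 => x a0 _.
rewrite lne_EFin// -EFinD -lnM ?posrE ?ltr_pwDl//.
congr (ln _)%:E; rewrite addrCA one_add_excess//.
by rewrite -/(b x); ring.
Qed.

End log_summable.

(** * Quasi-invariance *)

Section mul_map_integral.
Context d (X : measurableType d) (R : realType) (a : X -> {nonneg R}).

Lemma integral_mul_map (eta : Dplus X R) (f : X -> R) :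
  measurable_fun setT (fun x => (a x)%:num) ->
  measurable_fun setT f -> (forall x, 0 <= f x) -> mul_defined a eta ->
  (\int[mul_map a eta]_x (f x)%:E = \int[eta]_x ((a x)%:num * f x)%:E)%E.
Proof.
move=> ma mf f0 aeta; rewrite mul_mapE// [in RHS]atomsE /mul_atomic.
rewrite !ge0_integral_atomic_measure//.
- apply: eq_eseriesr => i _ /=.
  by rewrite !diracT !mul1e -!EFinM mulrA [_ * (a _)%:num]mulrC.
- by apply/measurable_EFinP; exact: measurable_funM.
- by move=> x _; rewrite lee_fin mulr_ge0.
- exact/measurable_EFinP.
- by move=> x _; rewrite lee_fin.
Qed.

End mul_map_integral.

Section quasi_invariance.
Context d (X : measurableType d) (R : realType)
  (nu : {finite_measure set X -> \bar R}) (P : probability (Dplus X R) R)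
  (a : X -> {nonneg R}).
Hypotheses (P_gamma : is_gamma_measure nu P) (a_log : log_summable nu a).

Let ma : measurable_fun setT (fun x => (a x)%:num).
Proof. by have [] := a_log. Qed.

(** [1 + q] is the weight [g0], and [1 + p] is [a g0] where [a] is positive. *)
Let p x := excess (a x)%:num.
Let q x := excess ((a x)%:num)^-1.

Let mp : measurable_fun setT p. Proof. exact: measurable_excess. Qed.
Let mq : measurable_fun setT q.
Proof. exact/measurable_excess/(measurable_inv_num a_log). Qed.
Let p0 x : 0 <= p x. Proof. exact: excess_ge0. Qed.
Let q0 x : 0 <= q x. Proof. exact: excess_ge0. Qed.
Let mM := measurable_mul_map ma.

Let c : {nonneg R} := NngNum (expR_ge0 (- fine (\int[nu]_x lne (a x)%:num%:E)%E)).

Lemma lne_int_fin : (\int[nu]_x lne (a x)%:num%:E)%E \is a fin_num.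
Proof. exact: integrable_fin_num (integrable_lne a_log). Qed.

Lemma ae_mul_defined : {ae P, forall eta, mul_defined a eta}.
Proof.
apply: filterS (gamma_ae_finite P_gamma ma _ (ln_one_add_lty a_log)) => // eta.
by rewrite /mul_defined/= mul_atomic_integral.
Qed.

Lemma ae_gt0 :
  {ae P, forall eta : Dplus X R, {ae eta, forall x, 0 < (a x)%:num}}.
Proof.
have mA : measurable [set x | (a x)%:num <= 0].
  rewrite (_ : [set x | _] = (fun x => (a x)%:num) @^-1` `]-oo, 0]%classic).
    by rewrite -[X in measurable X]setTI; exact: ma.
  by apply/seteqP; split => x; rewrite /= in_itv.
have nuA : nu [set x | (a x)%:num <= 0] = 0%E.
  have [N [mN N0 sN]] := log_summable_gt0 a_log.
  apply: (subset_measure0 mA mN _ N0) => x /= ax; apply: sN => /=.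
  by apply/negP; rewrite -leNgt.
apply: filterS (gamma_ae_null P_gamma mA nuA) => eta etaA.
exists [set x | (a x)%:num <= 0]; split => // x /= /negP.
by rewrite -leNgt.
Qed.

Let ae_q_finite : {ae P, forall eta : Dplus X R, \int[eta]_x (q x)%:E < +oo}%E.
Proof. exact: (gamma_ae_finite P_gamma mq q0 (ln_one_add_excessV_lty a_log)). Qed.

(** The quasi-Lebesgue measure and its image under [M_a], both weighted by
    [exp (- eta(g0))] and written in terms of the gamma measure. *)
Let mu1 := with_density P (measurable_expN_int mq q0) (fun eta => expN_int_ge0 q eta).
Let mu2 := image_measure
  (with_density P (measurable_expN_int mp p0) (fun eta => expN_int_ge0 p eta)) mM.

Let int_mu1 (F : Dplus X R -> \bar R) : measurable_fun setT F -> (forall eta, 0 <= F eta)%E ->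
  (\int[mu1]_eta F eta = \int[P]_eta (F eta * expN_int q eta))%E.
Proof.
move=> mF F0; apply: ge0_integral_has_density => //.
- exact: measurable_expN_int.
- by move=> eta; exact: expN_int_ge0.
- by move=> eta; exact: expN_int_fin_num.
Qed.

Let int_mu2 (F : Dplus X R -> \bar R) : measurable_fun setT F -> (forall eta, 0 <= F eta)%E ->
  (\int[mu2]_eta F eta = \int[P]_eta (F (mul_map a eta) * expN_int p eta))%E.
Proof.
move=> mF F0; rewrite ge0_integral_pushforward//.
rewrite preimage_setT; apply: ge0_integral_has_density => //.
- exact: measurable_expN_int.
- by move=> eta; exact: expN_int_ge0.
- by move=> eta; exact: expN_int_fin_num.
- exact: measurableT_comp.
- by move=> eta; exact: F0.
Qed.

Let cE : (c%:num)%:E = expeR (- \int[nu]_x lne (a x)%:num%:E)%E.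
Proof. by rewrite -[in RHS](fineK lne_int_fin). Qed.

(** Both sides have the Laplace functional
    [h |-> exp (- \int log (a (g0 + h)))]. *)
Let mu2E B : measurable B -> mu2 B = mscale c mu1 B.
Proof.
have fin (f : X -> R) (mf : measurable_fun setT f) (f0 : forall x, 0 <= f x) :
    (\int[P]_eta expN_int f eta < +oo)%E.
  apply: (@le_lt_trans _ _ (\int[P]_eta cst 1 eta)%E).
    apply: ge0_le_integral => //.
    - by move=> eta _; exact: expN_int_ge0.
    - exact: measurable_expN_int.
    - by move=> eta _; exact: expN_int_le1.
  rewrite integral_cst// mul1e.
  by rewrite (le_lt_trans (probability_le1 P measurableT))// ltry.
apply: eq_measure_Dplus.
- exact: fin.
- rewrite /mscale/= lte_mul_pinfty ?lee_fin//.
  exact: fin.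
move=> h bh; have [mh h0 _] := bh.
have mE : measurable_fun setT (expN_int (X := X) (R := R) h) by exact: measurable_expN_int.
have E0 eta := expN_int_ge0 (X := X) (R := R) h eta.
rewrite int_mu2// ge0_integral_mscale// int_mu1//.
transitivity (\int[P]_eta expN_int (fun x => (a x)%:num * h x + p x)%R eta)%E.
  apply: ge0_ae_eq_integral => //.
  - apply: emeasurable_funM; last exact: measurable_expN_int.
    exact: measurableT_comp.
  - apply: measurable_expN_int; first by apply: measurable_funD => //; exact: measurable_funM.
    by move=> x; rewrite addr_ge0// mulr_ge0.
  - by move=> eta _; rewrite mule_ge0// expN_int_ge0.
  - by move=> eta _; exact: expN_int_ge0.
  apply: filterS ae_mul_defined => eta aeta _.
  rewrite (@expN_intD _ _ _ (fun x => (a x)%:num * h x) p)//.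
  - by rewrite /expN_int integral_mul_map.
  - exact: measurable_funM.
  - by move=> x; rewrite mulr_ge0.
rewrite (gamma_laplace P_gamma); last 2 first.
- by apply: measurable_funD => //; exact: measurable_funM.
- by move=> x; rewrite addr_ge0// mulr_ge0.
rewrite (integral_ln_one_add_mul a_log bh).
under [in RHS]eq_integral do rewrite -expN_intD//.
rewrite (gamma_laplace P_gamma); last 2 first.
- exact: measurable_funD.
- by move=> x; rewrite addr_ge0.
by rewrite cE -expeRD addeC fin_num_oppeD ?lne_int_fin// addeC.
Qed.

(** [exp (eta(g0))], by which the weight is removed. *)
Let W (eta : Dplus X R) : \bar R := expeR (\int[eta]_x (1 + q x)%:E)%E.

Let mW : measurable_fun setT W.
Proof.
apply: (measurableT_comp (@measurable_expeR R)).
apply: measurable_Dplus_integral; first by apply/measurable_EFinP; exact: measurable_funD.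
by move=> x; rewrite lee_fin addr_ge0.
Qed.

Let int_1D (eta : Dplus X R) (f : X -> R) : measurable_fun setT f -> (forall x, 0 <= f x) ->
  (\int[eta]_x (1 + f x)%:E = eta setT + \int[eta]_x (f x)%:E)%E.
Proof.
move=> mf f0; under eq_integral do rewrite EFinD.
rewrite ge0_integralD//; first by rewrite integral_cst// mul1e.
- by move=> x _; rewrite lee_fin.
- exact/measurable_EFinP.
Qed.

Let expeR_cancel (eta : Dplus X R) (f : X -> R) :
  measurable_fun setT f -> (forall x, 0 <= f x) ->
  (\int[eta]_x (f x)%:E < +oo)%E ->
  (expeR (\int[eta]_x (1 + f x)%:E) * expN_int f eta = expeR (eta setT))%E.
Proof.
move=> mf f0 foo; rewrite int_1D// /expN_int -expeRD -addeA subee ?adde0//.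
by rewrite ge0_fin_numE//; apply: integral_ge0 => x _; rewrite lee_fin.
Qed.

(** The weight can be removed from [mu2E] because [eta(g0)] is almost surely finite
    for both measures. *)
Lemma quasi_lebesgue_mul_map B : measurable B ->
  pushforward (quasi_lebesgue P) (mul_map a) B =
  ((c%:num)%:E * quasi_lebesgue P B)%E.
Proof.
move=> mB.
have indB (D : set (Dplus X R)) (F : Dplus X R -> \bar R) : measurable D ->
    (\int[P]_(eta in D) F eta = \int[P]_eta ((\1_D eta)%:E * F eta))%E.
  move=> mD; rewrite integral_mkcond; apply: eq_integral => eta _.
  by rewrite patchE indicE; case: ifPn => _; rewrite ?mul1e ?mul0e.
have mD : measurable (mul_map a @^-1` B).
  by rewrite -[X in measurable X]setTI; exact: mM.
have m1 (D : set (Dplus X R)) : measurable D ->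
    measurable_fun setT (fun eta : Dplus X R => (\1_D eta)%:E : \bar R).
  by move=> mD'; apply/measurable_EFinP; exact: measurable_indic.
have W0 eta : (0 <= W eta)%E by exact: expeR_ge0.
have m1W : measurable_fun setT (fun eta => (\1_B eta)%:E * W eta)%E.
  by apply: emeasurable_funM => //; exact: m1.
have W10 eta : (0 <= (\1_B eta)%:E * W eta)%E by rewrite mule_ge0// lee_fin.
transitivity (\int[mu2]_eta ((\1_B eta)%:E * W eta))%E.
  rewrite int_mu2// /pushforward /quasi_lebesgue indB//.
  apply: ge0_ae_eq_integral => //.
  - by apply: emeasurable_funM; [exact: m1|exact: measurable_expeR_mass].
  - apply: emeasurable_funM; last exact: measurable_expN_int.
    exact: (measurableT_comp m1W).
  - by move=> eta _; rewrite mule_ge0 ?lee_fin// expeR_ge0.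
  - by move=> eta _; rewrite mule_ge0// expN_int_ge0.
  apply: filterS2 ae_mul_defined ae_gt0 => eta aeta eta0 _.
  rewrite -muleA; congr (_ * _)%E; rewrite /W integral_mul_map//; last 2 first.
  - exact: measurable_funD.
  - by move=> x; rewrite addr_ge0.
  (* [eta] has no atom at a zero of [a], so [eta(a g0) = eta(1 + p)]. *)
  rewrite (_ : \int[eta]_x _ = \int[eta]_x (1 + p x)%:E)%E.
    rewrite expeR_cancel// (@le_lt_trans _ _ (\int[eta]_x (a x)%:num%:E)%E)//.
      apply: ge0_le_integral => //.
      - by move=> x _; rewrite lee_fin.
      - exact/measurable_EFinP.
      - exact/measurable_EFinP.
      - by move=> x _; rewrite lee_fin excess_le.
    by move: aeta; rewrite /mul_defined/= mul_atomic_integral.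
  apply: ae_eq_integral => //.
  - by apply/measurable_EFinP/measurable_funM => //; exact: measurable_funD.
  - by apply/measurable_EFinP; exact: measurable_funD.
  - by apply: filterS eta0 => x ax _; congr EFin; exact/esym/one_add_excess.
transitivity (\int[mscale c mu1]_eta ((\1_B eta)%:E * W eta))%E.
  by apply: eq_measure_integral => D mD' _; exact: mu2E.
rewrite ge0_integral_mscale// int_mu1//; congr (_ * _)%E.
rewrite /quasi_lebesgue (indB B)//.
apply: ge0_ae_eq_integral => //.
- by apply: emeasurable_funM => //; exact: measurable_expN_int.
- by apply: emeasurable_funM; [exact: m1|exact: measurable_expeR_mass].
- by move=> eta _; rewrite mule_ge0// expN_int_ge0.
- by move=> eta _; rewrite mule_ge0 ?lee_fin// expeR_ge0.
by apply: filterS ae_q_finite => eta qoo _; rewrite -muleA expeR_cancel.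
Qed.

End quasi_invariance.

Theorem theorem6 (R : realType) (d : measure_display) (X : measurableType d)
    (nu : {finite_measure set X -> \bar R})
    (P : probability (Dplus X R) R) (a : X -> {nonneg R})
    (X_standard : standard_borel R X) (nu_non_atomic : non_atomic nu)
    (P_gamma : is_gamma_measure nu P) (a_in_M : log_summable nu a) :
  let Q := quasi_lebesgue P in
  let MQ := pushforward Q (mul_map a) in
  [/\ {ae Q, forall eta, mul_defined a eta},
      MQ `<< Q,
      Q `<< MQ &
      has_density Q MQ (fun=> expeR (- \int[nu]_x lne (a x)%:num%:E)%E)].
Proof.
move=> Q MQ.
have QP N : measurable N -> P N = 0%E -> Q N = 0%E.
  move=> mN PN; apply: null_set_integral => //.
  by apply: measurable_funTS; exact: measurable_expeR_mass.
set c := expeR _.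
have MQE B : measurable B -> MQ B = (c * Q B)%E.
  move=> mB; rewrite /MQ (quasi_lebesgue_mul_map P_gamma a_in_M mB) /c.
  by rewrite -[in RHS](fineK (lne_int_fin a_in_M)).
have c0 : (c != 0)%E.
  rewrite expeR_eq0; apply/eqP => /(congr1 (fun x => - x)%E); rewrite oppeK/= => coo.
  by have := lne_int_fin a_in_M; rewrite coo.
have [ma _] := a_in_M.
split.
- have [N [mN N0 sN]] := ae_mul_defined P_gamma a_in_M.
  by exists N; split => //; exact: QP.
- apply/null_content_dominatesP => B mB QB.
  by rewrite MQE// [X in (_ * X)%E]QB mule0.
- apply: (null_content_dominatesP Q (image_measure Q (measurable_mul_map ma))).2.
  move=> B mB MQB; have := MQE B mB; rewrite [MQ B]MQB => /esym/eqP.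
  by rewrite mule_eq0 (negbTE c0) => /eqP.
- by move=> B mB; rewrite MQE// integral_cst.
Qed.
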